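(* Let $s \ge 3$ be a fixed integer, and for each $\varepsilon > 0$ let $C_\varepsilon > 0$ be a constant. There exist a constant $c = c(s) > 0$ depending only on $s$ and a number $k_0 \ge 3$, depending only on $s$ and on the family $(C_\varepsilon)_{\varepsilon>0}$, such that the following holds for every $\mathbf{a} = (a_1,\dots,a_s)\in\mathbb{Z}^s$ and every integer $k \ge k_0$. If $$\left| \pi(X;k,1) - \frac{1}{\varphi(k)}\mathrm{Li}(X) \right| \le C_\varepsilon\, \frac{X^{1/2+\varepsilon}}{k^{1/2}}$$ for every $\varepsilon > 0$ and every real $X \ge k^{1+\varepsilon}$, then $$\log(1/\delta_k) \ \ge\ c\, \frac{k^{\frac{1}{s-1}}}{\log k}.$$
   Context: For an integer $k \ge 1$ and $\mathbf{a} = (a_1,\dots,a_s)\in\mathbb{Z}^s$, let $F_{\mathbf{a},k}(\mathbf{x}) = a_1 x_1^k + \cdots + a_s x_s^k$, let $\mathcal{R}(\mathbf{a},k) = \{ n : n = F_{\mathbf{a},k}(\mathbf{x}) \text{ for some } \mathbf{x}\in\mathbb{Z}^s\}$, and let $$\delta_k = \limsup_{N\to\infty} \frac{|\mathcal{R}(\mathbf{a},k)\cap[1,N]|}{N},$$ which depends implicitly on $\mathbf{a}$. Convention: $\log(1/\delta_k) = \infty$ when $\delta_k = 0$. Here $\pi(X;k,1)$ is the number of primes $p < X$ with $p \equiv 1 \pmod{k}$, $\varphi$ is Euler's totient function, and $\mathrm{Li}(X) = \int_2^X \frac{dt}{\log t}$ is the logarithmic integral. *)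

(* Defs.v *)
From HB Require Import structures.
From mathcomp Require Import all_boot all_order all_algebra.
From mathcomp Require Import finmap.
From mathcomp Require Import all_classical all_reals all_analysis.

Set Implicit Arguments.
Unset Strict Implicit.
Unset Printing Implicit Defensive.

Import Order.TTheory GRing.Theory Num.Theory.
Import numFieldNormedType.Exports.

Local Open Scope classical_set_scope.
Local Open Scope ring_scope.

Definition diag_form (s : nat) (a : 'I_s -> int) (k : nat) (x : 'I_s -> int)
    : int :=
  \sum_(i < s) a i * x i ^+ k.

Definition represented (s : nat) (a : 'I_s -> int) (k : nat) : set int :=
  [set n | exists x : 'I_s -> int, n = diag_form a k x].

Definition represented_upto (s : nat) (a : 'I_s -> int) (k N : nat) : set int :=
  represented a k `&` [set n | 1 <= n <= N%:Z].

(* [fset_set A] is the empty finite set when [A] is infinite, so cardinals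
   are meaningful here because of this lemma and [finite_primes_1mod]. *)
Lemma finite_represented_upto (s : nat) (a : 'I_s -> int) (k N : nat) :
  finite_set (represented_upto a k N).
Proof.
apply: (@sub_finite_set _ _ [set Posz n | n in `I_N.+1]).
  by move=> [n|n] [_ /=] // /andP[_ nN]; exists n.
exact/finite_image/finite_II.
Qed.

(* Valued in [\bar R] so that [lne (upper_density a k)^-1] is the logarithm of
   its inverse, with value [+oo] when the density is 0 (by [inve0]).  The term
   of index 0 is irrelevant to the upper limit. *)
Definition upper_density (R : realType) (s : nat) (a : 'I_s -> int) (k : nat)
    : \bar R :=
  limn_esup (fun N : nat =>
    ((#|` fset_set (represented_upto a k N)|)%:R / N%:R : R)%:E).

Definition primes_1mod (R : realType) (X : R) (k : nat) : set nat :=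
  [set p | [/\ prime p, p%:R < X & p = 1 %[mod k]]].

Lemma finite_primes_1mod (R : realType) (X : R) (k : nat) :
  finite_set (primes_1mod X k).
Proof.
apply: (@sub_finite_set _ _ `I_(Num.truncn X).+1); last exact: finite_II.
move=> p [_ pX _] /=; rewrite -(ltr_nat R).
exact: lt_trans pX (truncnS_gt X).
Qed.

Definition prime_pi_1mod (R : realType) (X : R) (k : nat) : nat :=
  #|` fset_set (primes_1mod X k)|.

(* The logarithmic integral for [2 <= X]; it is 0 when [X < 2]. *)
Definition Li (R : realType) (X : R) : R :=
  \int[@lebesgue_measure R]_(t in `[2, X]) (ln t)^-1.

(* Main.v *)
(* Let p be a prime with p = 1 mod k.  There are at most (p - 1) / k + 1 k-th
   powers modulo p, so the form takes at most ((p - 1) / k + 1)^s <= (2p/k)^s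
   residues modulo p, which is at most p / 4 as soon as
   p < X := k^(s/(s-1)) / 16.  By the Chinese remainder theorem each of the
   r := pi(X; k, 1) such primes thins out the represented integers by a factor
   4, independently of the others, so that delta_k <= 2 * 4^-r <= 2^-r.
   Finally the hypothesis with eps = 1 / (4s) gives
   r >= k^(1/(s-1)) / (128 log k): the main term is X / (k log X), up to a
   constant, and the error is at most C_eps k^(3/(4(s-1))). *)
Require Import Defs.
From mathcomp Require Import all_boot all_order all_algebra all_field.
From mathcomp Require Import finmap zify ring lra.
From mathcomp Require Import all_classical all_reals all_analysis.

Set Implicit Arguments.
Unset Strict Implicit.
Unset Printing Implicit Defensive.

Import Order.TTheory GRing.Theory Num.Theory.
Import numFieldNormedType.Exports.

Local Open Scope ring_scope.

(** * Values of the form over a finite field *)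

Lemma leq_expnl (m n e : nat) : (m <= n)%N -> (m ^ e <= n ^ e)%N.
Proof. by case: e => // e mn; rewrite leq_exp2r. Qed.

(** If [y = x ^+ k], then [y ^+ m.+1 = x ^+ (k * m + k) = y], because [x ^+ #|F| = x] for every [x],
    zero included. So all k-th powers are roots of the nonzero polynomial ['X^(m.+1) - 'X]. *)
Lemma card_power_values (F : finFieldType) (k m : nat) :
  #|F|.-1 = (k * m)%N -> (#|[set (x ^+ k)%R | x in F]%SET| <= m.+1)%N.
Proof.
move=> cardF; have F1 : (1 < #|F|)%N := finNzRing_gt1 F.
have cardF' : #|F| = (k * m).+1 by rewrite -cardF prednK // ltnW.
have [k0 m0] : (0 < k)%N /\ (0 < m)%N.
  by apply/andP; rewrite -muln_gt0 -ltnS -cardF'.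
have szP : size ('X^(m.+1) - 'X : {poly F}) = m.+2.
  by rewrite size_polyDl ?size_polyXn// size_polyN size_polyX.
rewrite cardE -ltnS -szP; apply: max_poly_roots; last exact: enum_uniq.
  by rewrite -size_poly_gt0 szP.
apply/allP => y; rewrite mem_enum => /imsetP[x _ ->].
rewrite rootE !hornerE subr_eq0 -exprM mulnS.
rewrite -[X in (X + _)%N](prednK k0) addSnnS exprD -cardF' expf_card -exprSr.
by rewrite prednK.
Qed.

Definition diag_values (s : nat) (a : 'I_s -> int) (k : nat)
    (F : finFieldType) : {set F} :=
  [set \sum_(i < s) (a i)%:~R * f i
     | f : {ffun 'I_s -> F} in ffun_on [set x ^+ k | x in F]%SET]%SET.

Lemma card_diag_values (s : nat) (a : 'I_s -> int) (k m : nat)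
    (F : finFieldType) :
  #|F|.-1 = (k * m)%N -> (#|diag_values a k F| <= m.+1 ^ s)%N.
Proof.
move=> cardF; apply: (leq_trans (leq_imset_card _ _)).
by rewrite card_ffun_on card_ord leq_expnl// card_power_values.
Qed.

Lemma represented_diag_values (s : nat) (a : 'I_s -> int) (k : nat) (n : int)
    (F : finFieldType) : represented a k n -> n%:~R \in diag_values a k F.
Proof.
case=> x ->; apply/imsetP; exists [ffun i => (x i)%:~R ^+ k].
  by apply/ffun_onP => i; rewrite ffunE; apply/imsetP; exists (x i)%:~R.
rewrite /diag_form (rmorph_sum (@intmul F 1)); apply: eq_bigr => i _.
by rewrite ffunE rmorphM rmorphXn.
Qed.

(** * Sieving by the Chinese remainder theorem *)

Definition in_residues (V : forall p, {set 'F_p}) (l : seq nat) (n : nat)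
    : bool :=
  all (fun p => n%:R \in V p) l.

Lemma natr_Fp_dvd (p M n : nat) : prime p -> (p %| M)%N ->
  (n %% M)%:R = n%:R :> 'F_p.
Proof.
by move=> pp pM; rewrite -[LHS]Fp_nat_mod// modn_dvdm// Fp_nat_mod.
Qed.

Lemma in_residues_mod (V : forall p, {set 'F_p}) (l : seq nat) (M n : nat) :
  all prime l -> all (fun p => p %| M)%N l ->
  in_residues V l (n %% M) = in_residues V l n.
Proof.
move=> /allP lp /allP lM; apply: eq_in_all => p pl.
by rewrite natr_Fp_dvd// ?lp// lM.
Qed.

Lemma all_dvdn_prod (l : seq nat) : all (fun p => p %| \prod_(q <- l) q)%N l.
Proof. by apply/allP => p pl; rewrite (big_rem p)//= dvdn_mulr. Qed.

Lemma prod_primes_gt0 (l : seq nat) : all prime l -> (0 < \prod_(p <- l) p)%N.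
Proof.
by move=> lp; rewrite big_seq; apply: prodn_cond_gt0 => q /(allP lp)/prime_gt0.
Qed.

(** Induction on [l]: with [M] the product of the remaining primes, [n] maps to the pair of its
    class in ['F_p] and [n %% M]. This is injective below [p * M] and lands in [V p] times the set
    counted for the tail. *)
Lemma count_residues (V : forall p, {set 'F_p}) (l : seq nat) :
  uniq l -> all prime l ->
  (count (in_residues V l) (iota 0 (\prod_(p <- l) p))
     <= \prod_(p <- l) #|V p|)%N.
Proof.
elim: l => [|p l IH] /=; first by rewrite !big_nil.
case/andP=> pl ul /andP[pp lp]; rewrite !big_cons.
set M := (\prod_(q <- l) q)%N.
have co : coprime p M.
  rewrite prime_coprime//; apply/negP => pM; case/negP: pl.
  move: pM; rewrite /M Euclid_dvd_prod // big_has => /hasP[q ql /=].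
  by rewrite dvdn_prime2 ?(allP lp _ ql)// => /eqP->.
have M0 : (0 < M)%N := prod_primes_gt0 lp.
apply: leq_trans (leq_mul (leqnn _) (IH ul lp)).
rewrite -!size_filter cardE -(size_allpairs pair).
rewrite -(size_map (fun n => (n%:R : 'F_p, n %% M)%N)).
apply: uniq_leq_size.
  rewrite map_inj_in_uniq ?filter_uniq ?iota_uniq// => x y.
  rewrite !mem_filter !mem_iota !add0n /= => /andP[_ xl] /andP[_ yl] [exy exyM].
  suff /eqP : x == y %[mod p * M] by rewrite !modn_small.
  rewrite chinese_remainder// exyM eqxx andbT.
  by move/(congr1 val): exy; rewrite /= !val_Fp_nat // => ->.
move=> _ /mapP[n + ->]; rewrite mem_filter => /andP[/= /andP[nV nl] _].
apply: allpairs_f; first by rewrite mem_enum.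
rewrite mem_filter mem_iota add0n ltn_mod M0 !andbT.
by rewrite in_residues_mod ?all_dvdn_prod.
Qed.

(** Euclidean division by the product cuts the range into [N %/ M + 1] blocks, the incomplete last
    one being counted as a full period. *)
Lemma count_residues_upto (V : forall p, {set 'F_p}) (l : seq nat) (N : nat) :
  uniq l -> all prime l ->
  (count (in_residues V l) (iota 1 N)
     <= (N %/ \prod_(p <- l) p).+1 * \prod_(p <- l) #|V p|)%N.
Proof.
move=> ul lp; apply: leq_trans (leq_mul (leqnn _) (count_residues V ul lp)).
set M := (\prod_(p <- l) p)%N.
have M0 : (0 < M)%N := prod_primes_gt0 lp.
rewrite -[(N %/ M).+1](size_iota 0) -!size_filter -(size_allpairs pair).
rewrite -(size_map (fun n => (n %/ M, n %% M))%N).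
apply: uniq_leq_size.
  rewrite map_inj_in_uniq ?filter_uniq ?iota_uniq// => x y _ _ [ed em].
  by rewrite (divn_eq x M) (divn_eq y M) ed em.
move=> _ /mapP[n + ->]; rewrite mem_filter mem_iota => /andP[nl /andP[_ nN]].
apply: allpairs_f; first by rewrite mem_iota /= add0n ltnS leq_div2r.
rewrite mem_filter mem_iota add0n ltn_mod M0 !andbT.
by rewrite in_residues_mod ?all_dvdn_prod.
Qed.

Lemma card_represented_upto (s : nat) (a : 'I_s -> int) (k : nat)
    (l : seq nat) (N : nat) :
  uniq l -> all prime l ->
  (#|` fset_set (represented_upto a k N)|
     <= (N %/ \prod_(p <- l) p).+1 * \prod_(p <- l) #|diag_values a k 'F_p|)%N.
Proof.
move=> ul lp; set V := fun p => diag_values a k 'F_p.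
apply: leq_trans (count_residues_upto V N ul lp).
rewrite -size_filter -(size_map Posz); apply: uniq_leq_size => // n.
rewrite in_fset_set; last exact: finite_represented_upto.
rewrite inE => -[rn /=]; case: n rn => // n rn /andP[n1 nN].
rewrite mem_map; last by move=> ? ? [].
rewrite mem_filter mem_iota; apply/andP; split.
  2: by rewrite add1n ltnS; apply/andP.
by apply/allP => p _; exact: (represented_diag_values _ rn).
Qed.

Lemma card_represented_upto_sieve (s : nat) (a : 'I_s -> int) (k : nat)
    (l : seq nat) (N : nat) :
  uniq l -> all prime l ->
  all (fun p => 4 * #|diag_values a k 'F_p| <= p)%N l ->
  (\prod_(p <- l) p <= N)%N ->
  (#|` fset_set (represented_upto a k N)| * 4 ^ size l <= 2 * N)%N.
Proof.
move=> ul lp l4 MN; set M := (\prod_(p <- l) p)%N.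
apply: (leq_trans (leq_mul (card_represented_upto a k N ul lp) (leqnn _))).
rewrite -/M -mulnA.
have H : (\prod_(p <- l) #|diag_values a k 'F_p| * 4 ^ size l <= M)%N.
  have -> : (4 ^ size l = \prod_(p <- l) 4)%N.
    by rewrite big_const_seq count_predT iter_muln_1.
  rewrite -big_split /= /M big_seq [leqRHS]big_seq.
  by apply: leq_prod => p /(allP l4); rewrite mulnC.
(* What remains is [(N %/ M + 1) * M <= N + M <= 2 * N]: the factor 2 pays for the incomplete
   block. *)
apply: leq_trans (leq_mul (leqnn _) H) _.
by rewrite mulSn mul2n -addnn leq_add// leq_trunc_div.
Qed.

Lemma diag_values_sparse (s : nat) (a : 'I_s -> int) (k p : nat) :
  (0 < k)%N -> prime p -> p = 1 %[mod k] ->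
  (2 ^ s.+2 * p ^ s <= k ^ s * p)%N ->
  (4 * #|diag_values a k 'F_p| <= p)%N.
Proof.
move=> k0 pp p1 Hp.
have kp : (k %| p.-1)%N by rewrite -subn1 -eqn_mod_dvd ?prime_gt0//; apply/eqP.
have p2 : (0 < p.-1)%N by rewrite -subn1 subn_gt0 prime_gt1.
have km : p.-1 = (k * (p.-1 %/ k))%N by rewrite mulnC divnK.
have := @card_diag_values s a k (p.-1 %/ k)%N 'F_p.
rewrite card_Fp// => /(_ km) Hc.
set m := (p.-1 %/ k)%N in km Hc.
have m0 : (0 < m)%N by case: m km Hc => // e; rewrite e muln0 in p2.
(* As [m >= 1], [k <= k * m = p - 1], so [k * m.+1] is at most [2 * (p - 1)]. *)
have kmp : (k * m.+1 <= 2 * p)%N by nia.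
rewrite -(@leq_pmul2l (k ^ s)) ?expn_gt0 ?k0//.
apply: leq_trans Hp.
apply: (@leq_trans (4 * (k * m.+1) ^ s)%N).
  by rewrite expnMn mulnCA; do 2 apply: leq_mul => //.
by rewrite !expnS mulnA -mulnA -expnMn leq_mul// leq_expnl.
Qed.

(** * Logarithmic integral, upper limits and logarithms *)

Lemma Li_ge (R : realType) (X : R) : 2 <= X -> (X - 2) / ln X <= Li X.
Proof.
move=> X2.
have lnX : 0 < ln X by rewrite ln_gt0//; lra.
have itvE (f : R -> R) : {within `[2, X], continuous f}%classic ->
    lebesgue_measure.-integrable `[2, X]%classic (EFin \o f).
  by apply: continuous_compact_integrable; exact: segment_compact.
have -> : (X - 2) / ln X =
    \int[@lebesgue_measure R]_(t in `[2, X]) (cst (ln X)^-1 t).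
  rewrite /Rintegral (_ : (fun t => (cst (ln X)^-1 t)%:E) = cst (ln X)^-1%:E)//.
  rewrite integral_cst//= lebesgue_measure_itv/= lte_fin.
  have [_|] := ltrP 2 X; first by rewrite -EFinB -EFinM mulrC.
  (* For [X = 2] the interval is a point, and both sides vanish. *)
  by move=> X2'; rewrite (_ : X - 2 = 0) ?mul0r/= ?mulr0//; lra.
(* The integrand decreases on [[2, X]], so it is bounded below by its value at [X]. *)
apply: le_Rintegral => //.
- by apply: itvE; apply: continuous_subspaceT => x; exact: cvg_cst.
- apply: itvE; apply: continuous_in_subspaceT => x.
  rewrite inE /= in_itv /= => /andP[x2 _].
  apply: cvgV; first by rewrite gt_eqF// ln_gt0//; lra.
  by apply: continuous_ln; lra.
- move=> x /=; rewrite in_itv /= => /andP[x2 xX].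
  by rewrite lef_pV2 ?posrE ?ln_gt0 ?ler_ln ?posrE//; lra.
Qed.

Lemma limn_esup_le_eventually (R : realType) (u : nat -> \bar R)
    (b : \bar R) (M : nat) :
  (forall n, (M <= n)%N -> (u n <= b)%E) -> (limn_esup u <= b)%E.
Proof.
move=> ub; rewrite /limn_esup limf_esupE.
apply: (@le_trans _ _
  (ereal_sup [set u n | n in [set n | (M <= n)%N]]%classic)).
  apply: ereal_inf_lbound; exists [set n | (M <= n)%N]%classic => //.
  by exists M.
by apply: ge_ereal_sup => _ [n Mn <-]; exact: ub.
Qed.

(** Inversion and logarithm are monotone on the nonnegative extended reals, so density 0, where the
    right side is [+oo], needs no separate case. *)
Lemma ln2_le_lne_inve (R : realType) (d : \bar R) (r : nat) :
  (0 <= d)%E -> (d <= (2^-1 ^+ r)%:E)%E -> ((r%:R * ln 2)%:E <= lne d^-1)%E.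
Proof.
move=> d0 dr.
have p0 : 0 < 2^-1 ^+ r :> R by rewrite exprn_gt0//; lra.
have -> : (r%:R * ln 2)%:E = lne ((2^-1 ^+ r)%:E^-1) :> \bar R.
  rewrite inver gt_eqF// exprVn invrK lne_EFin ?exprn_gt0//.
  by rewrite lnXn// mulr_natl.
rewrite lee_lne ?in_itv /= ?leey ?andbT ?inve_ge0 ?lee_fin ?(ltW p0)//.
by rewrite lee_pV2// inE lee_fin ltW.
Qed.

Lemma ln_le_powR (R : realType) (x t : R) :
  0 < t -> 0 < x -> ln x <= t^-1 * x `^ t.
Proof.
move=> t0 x0; rewrite -ler_pdivrMl ?invr_gt0// invrK -ln_powR.
exact/ltW/ln_sublinear/powR_gt0.
Qed.

Lemma upper_density_ge0 (R : realType) (s : nat) (a : 'I_s -> int) (k : nat) :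
  (0 <= upper_density R a k)%E.
Proof.
apply: limf_esup_ge0 => [|N]; last by rewrite lee_fin divr_ge0.
by case=> N _ /(_ N); apply => /=.
Qed.

Lemma upper_density_sieve (R : realType) (s : nat) (a : 'I_s -> int) (k : nat)
    (l : seq nat) :
  uniq l -> all prime l -> (0 < size l)%N ->
  all (fun p => 4 * #|diag_values a k 'F_p| <= p)%N l ->
  (upper_density R a k <= (2^-1 ^+ size l)%:E)%E.
Proof.
move=> ul lp l0 l4; set M := (\prod_(p <- l) p)%N.
have M0 : (0 < M)%N := prod_primes_gt0 lp.
apply: (@limn_esup_le_eventually _ _ _ M) => N MN.
have N0 : (0 < N)%N by exact: leq_trans MN.
rewrite lee_fin ler_pdivrMr ?ltr0n// exprVn ler_pdivlMl ?exprn_gt0//.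
rewrite -natrX -natrM ler_nat.
have := card_represented_upto_sieve ul lp l4 MN.
have -> : (4 ^ size l = 2 ^ size l * 2 ^ size l)%N by rewrite -expnMn.
(* A nonempty list lets one factor [2 ^ size l] absorb the 2 of the sieve bound. *)
have : (2 <= 2 ^ size l)%N by rewrite -[leqLHS]expn1 leq_exp2l.
nia.
Qed.

(** * Size and number of the sieving primes *)

Lemma prime_bound_sparse (R : realType) (s k p : nat) :
  (3 <= s)%N -> p%:R < k%:R `^ (1 + (s%:R - 1)^-1) / 16 :> R ->
  (2 ^ s.+2 * p ^ s <= k ^ s * p)%N.
Proof.
case: s => [//|[//|u]] _; rewrite -[X in X - 1]natr1 addrK => pX.
rewrite -(ler_nat R) (natrM _ (2 ^ _)) (natrM _ (k ^ _)) !natrX.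
(* Here [s = u + 2]; raising the bound on [p] to the power [s - 1] clears the fractional exponent.
   The constant 16 then suffices, because [s + 2 <= 4 * (s - 1)]. *)
have pu : p%:R ^+ u.+1 <= k%:R ^+ u.+2 / 16 ^+ u.+1 :> R.
  have -> : k%:R ^+ u.+2 / 16 ^+ u.+1
      = (k%:R `^ (1 + u.+1%:R^-1) / 16) ^+ u.+1 :> R.
    rewrite expr_div_n -[in RHS]powR_mulrn ?powR_ge0// -powRrM.
    by rewrite mulrDl mul1r mulVf ?pnatr_eq0// natr1 powR_mulrn.
  by rewrite lerXn2r ?nnegrE ?divr_ge0 ?powR_ge0// ltW.
have h16 : 2 ^+ u.+4 <= 16 ^+ u.+1 :> R.
  by rewrite -!natrX ler_nat -[16%N]/(2 ^ 4)%N -expnM leq_exp2l//; lia.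
rewrite [X in _ * X]exprSr mulrA ler_wpM2r//.
apply: le_trans (ler_wpM2r _ h16) _; first exact: exprn_ge0.
by rewrite mulrC -ler_pdivlMr ?exprn_gt0.
Qed.

Lemma prime_count_ge (R : realType) (t e C K phi P : R) :
  0 < t <= 2^-1 -> 0 < e -> e * (1 + t) = t / 4 -> 0 < C ->
  64 <= K -> 1024 * C / t <= K `^ (t / 8) -> 16 <= K `^ (t / 8) ->
  0 < phi <= K ->
  let X := K `^ (1 + t) / 16 in
  (K `^ (1 + e) <= X ->
   `|P - phi^-1 * Li X| <= C * (X `^ (2^-1 + e) / K `^ 2^-1)) ->
  K `^ t / (128 * ln K) <= P.
Proof.
move=> /andP[t0 t1] e0 et C0 K64 KC K16 /andP[p0 pK] X HX.
have K0 : 0 < K by lra.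
have K1 : 1 <= K by lra.
have Kn0 : K != 0 by rewrite gt_eqF.
have lK : 0 < ln K by rewrite ln_gt0//; lra.
have KD (x y : R) : K `^ (x + y) = K `^ x * K `^ y.
  by rewrite powRD// Kn0 implybT.
have Kt1 : 1 <= K `^ t by rewrite -[leLHS](powRr0 K) ler_powR// ltW.
have X4 : 4 <= X.
  rewrite /X KD powRr1 ?(ltW K0)//.
  have : 64 * 1 <= K * K `^ t by rewrite ler_pM.
  lra.
have XK : X <= K `^ (1 + t).
  by rewrite /X; have := powR_gt0 (1 + t) K0; lra.
have e4 : e <= t / 4 by nra.
have {HX} : `|P - phi^-1 * Li X| <= C * (X `^ (2^-1 + e) / K `^ 2^-1).
  apply: HX; rewrite /X ler_pdivlMr//.
  have -> : 1 + t = (1 + e) + t / 8 + (t - e - t / 8) by lra.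
  rewrite (KD (1 + e + t / 8)) (KD (1 + e)) -mulrA ler_wpM2l ?powR_ge0//.
  have : 1 <= K `^ (t - e - t / 8).
    by rewrite -[leLHS](powRr0 K) ler_powR//; lra.
  by move=> h; rewrite -[leLHS]mulr1 ler_pM.
have err : X `^ (2^-1 + e) / K `^ 2^-1 <= K `^ (3 * t / 4).
  rewrite ler_pdivrMr ?powR_gt0// -KD.
  apply: (@le_trans _ _ ((K `^ (1 + t)) `^ (2^-1 + e))).
    by rewrite ge0_ler_powR ?nnegrE ?powR_ge0//; lra.
  (* By the choice of [e], [(1 + t) * (1 / 2 + e) = 1 / 2 + 3 * t / 4]. *)
  by rewrite -powRrM ler_powR//; nra.
have lnX : ln X <= 2 * ln K.
  rewrite -ln_powR ler_ln ?posrE ?powR_gt0//; last lra.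
  by apply: le_trans XK _; rewrite ler_powR//; lra.
have lX0 : 0 < ln X by rewrite ln_gt0//; lra.
have main : K `^ t / (64 * ln K) <= phi^-1 * Li X.
  (* From [X >= 4] comes [X - 2 >= X / 2], and [ln X <= 2 * ln K]. *)
  have LiX : X / (4 * ln K) <= Li X.
    apply: le_trans (Li_ge _); last lra.
    rewrite ler_pdivrMr; last by rewrite mulr_gt0.
    rewrite mulrAC ler_pdivlMr//; nra.
  apply: le_trans (_ : K^-1 * (X / (4 * ln K)) <= _).
    rewrite /X KD powRr1 ?(ltW K0)//.
    by rewrite le_eqVlt; apply/orP; left; apply/eqP; field; rewrite ?gt_eqF.
  apply: ler_pM => //.
  - by rewrite invr_ge0 ltW.
  - by rewrite divr_ge0 ?mulr_ge0 ?ltW//; lra.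
  - by rewrite lef_pV2 ?posrE.
have small : C * K `^ (3 * t / 4) <= K `^ t / (128 * ln K).
  have lnK8 : ln K <= 8 / t * K `^ (t / 8).
    have t8 : 0 < t / 8 by lra.
    by have := ln_le_powR t8 K0; rewrite invf_div.
  have -> : K `^ t = K `^ (3 * t / 4) * (K `^ (t / 8) * K `^ (t / 8)).
    by rewrite -!KD; congr (_ `^ _); lra.
  rewrite ler_pdivlMr; last by rewrite mulr_gt0.
  rewrite mulrAC mulrC ler_wpM2l ?powR_ge0//.
  apply: (@le_trans _ _ (1024 * C / t * K `^ (t / 8))).
    have -> : 1024 * C / t * K `^ (t / 8) = C * 128 * (8 / t * K `^ (t / 8)).
      by field; rewrite gt_eqF.
    by rewrite -mulrA; nra.
  by rewrite ler_wpM2r ?powR_ge0.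
have -> : K `^ t / (128 * ln K)
    = K `^ t / (64 * ln K) - K `^ t / (128 * ln K) by field; rewrite gt_eqF.
rewrite ler_norml => /andP[+ _].
have := ler_wpM2l (ltW C0) err.
lra.
Qed.

(** * Choice of the constants and assembly of the bounds *)

Theorem proposition2 (R : realType) (s : nat) (hs : (3 <= s)%N) :
  exists c : R, 0 < c /\
  forall C : R -> R, (forall eps : R, 0 < eps -> 0 < C eps) ->
  exists k0 : nat, (3 <= k0)%N /\
  forall (a : 'I_s -> int) (k : nat), (k0 <= k)%N ->
    (forall eps X : R, 0 < eps -> k%:R `^ (1 + eps) <= X ->
       `|(prime_pi_1mod X k)%:R - (totient k)%:R^-1 * Li X|
         <= C eps * (X `^ (2^-1 + eps) / k%:R `^ 2^-1)) ->
    ((c * (k%:R `^ (s%:R - 1)^-1 / ln k%:R))%:E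
       <= lne (upper_density R a k)^-1)%E.
Proof.
have ln2 : 0 < ln 2 :> R by rewrite ln_gt0//; lra.
(* The 128 comes from the prime count, and [ln 2] from the bound [2 ^ -r] on the density. *)
exists (ln 2 / 128); split; first by rewrite divr_gt0.
move=> C C_gt0.
have s3 : 3 <= s%:R :> R by rewrite ler_nat.
set t := (s%:R - 1)^-1 : R.
set e := (4 * s%:R)^-1 : R.
have t0 : 0 < t by rewrite invr_gt0; lra.
have t12 : t <= 2^-1 by rewrite lef_pV2 ?posrE; lra.
have e0 : 0 < e by rewrite invr_gt0; lra.
have et : e * (1 + t) = t / 4.
  by rewrite /e /t; field; rewrite ?gt_eqF//; lra.
have Ce := C_gt0 _ e0.
set B := Num.max 16 (1024 * C e / t).
have B16 : 16 <= B by rewrite le_max lexx.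
(* The second entry exceeds [B]^ (8 / t)[, which forces]B <= k [^ (t / 8)]. The family [C] enters
   only through its value at [e]. *)
exists (maxn 64 (Num.truncn (B `^ (8 / t))).+1); split.
  by rewrite leq_max.
move=> a k; rewrite geq_max => /andP[k64 kB] Hpi.
have K64 : 64 <= k%:R :> R by rewrite ler_nat.
have k0 : (0 < k)%N by exact: leq_trans k64.
have KB : B <= k%:R `^ (t / 8).
  have -> : B = (B `^ (8 / t)) `^ (t / 8).
    rewrite -powRrM (_ : 8 / t * (t / 8) = 1) ?powRr1//; first lra.
    by field; rewrite gt_eqF.
  rewrite ge0_ler_powR ?nnegrE ?powR_ge0//; first lra.
  apply/ltW/(lt_le_trans (truncnS_gt _)).
  by rewrite ler_nat.
set X : R := k%:R `^ (1 + t) / 16.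
have phi0 : 0 < (totient k)%:R :> R by rewrite ltr0n totient_gt0.
have phik : (totient k)%:R <= k%:R :> R.
  rewrite ler_nat.
  rewrite totient_count_coprime -[leqRHS]muln1.
  rewrite -[X in (X * _)%N]subn0 -sum_nat_const_nat.
  by apply: leq_sum => i _; exact: leq_b1.
have count : k%:R `^ t / (128 * ln k%:R) <= (prime_pi_1mod X k)%:R.
  apply: (@prime_count_ge _ t e (C e) k%:R (totient k)%:R) => //.
  - by rewrite t0.
  - by apply: le_trans KB; rewrite le_max lexx orbT.
  - exact: le_trans KB.
  - by rewrite phi0.
  - exact: Hpi.
set l : seq nat := fset_set (primes_1mod X k).
have lP p : p \in l -> [/\ prime p, p%:R < X & p = 1 %[mod k]].
  by rewrite /l in_fset_set ?inE//; exact: finite_primes_1mod.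
have lk : 0 < ln k%:R :> R by rewrite ln_gt0//; lra.
have l0 : (0 < size l)%N.
  (* The lower bound for the count is positive, so at least one sieving prime exists. *)
  rewrite -(ltr0n R); apply: lt_le_trans count.
  by rewrite divr_gt0 ?powR_gt0 ?mulr_gt0//; lra.
have lp : all prime l by apply/allP => p /lP[].
have dens : (upper_density R a k <= (2^-1 ^+ size l)%:E)%E.
  apply: upper_density_sieve => //; first exact: fset_uniq.
  apply/allP => p /lP[pp pX p1]; apply: diag_values_sparse => //.
  exact: prime_bound_sparse pX.
apply: le_trans (ln2_le_lne_inve (upper_density_ge0 _ _ _) dens).
rewrite lee_fin.
have -> : ln 2 / 128 * (k%:R `^ t / ln k%:R)
    = k%:R `^ t / (128 * ln k%:R) * ln 2.
  by field; rewrite gt_eqF.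
by rewrite ler_wpM2r// ltW.
Qed.
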